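(* Let $H$ be a Hilbert space. For every bounded sequence $(u_n)_{n \in \mathbb{N}}$ in $H$ the inequality $$\limsup_{N,M \to \infty} \left\|\frac{1}{N} \sum_{n=M+1}^{M+N} u_n\right\|^2 \leq \liminf_{J \to \infty} \frac{1}{J}\sum_{j=1}^J \limsup_{N,M \to \infty} \frac{1}{N}\sum_{n=M+1}^{N+M} \operatorname{Re} (u_n|u_{n+j})$$ holds.
   Context: $\mathbb{N} = \{1,2,3,\dots\}$. Hilbert spaces are complex, and $(\cdot|\cdot)$ denotes the inner product of $H$ (linear in the first argument). For a real double sequence, $\limsup_{N,M\to\infty} a_{N,M} = \inf_{K \in \mathbb{N}} \sup_{N,M \geq K} a_{N,M}$. *)

(* Defs.v *)
From HB Require Import structures.
From mathcomp Require Import all_boot all_order all_algebra.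
From mathcomp Require Import sesquilinear complex.
From mathcomp Require Import all_classical all_reals all_analysis.

Set Implicit Arguments.
Unset Strict Implicit.
Unset Printing Implicit Defensive.
Import Order.TTheory GRing.Theory Num.Theory.
Import numFieldNormedType.Exports.
Local Open Scope classical_set_scope.
Local Open Scope ring_scope.
Local Open Scope complex_scope.

(* A complex Hilbert space is a Banach space over R[i] whose norm comes from an
   inner product.  The forms {dot H for conjC} are linear in the first argument
   and conjugate-linear in the second. *)
HB.mixin Record isHilbert (R : realType) H of CompleteNormedModule R[i] H := {
  inner : {dot H for (@Num.conj R[i])} ;
  inner_normE : forall x : H, inner x x = `|x| ^+ 2
}.

#[short(type="hilbertType")]
HB.structure Definition Hilbert (R : realType) :=
  { H of isHilbert R H & CompleteNormedModule R[i] H }.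

(* The norm of a normed R[i]-module takes its values in R[i]; hnorm is the same
   norm with values in R. *)
Definition hnorm (R : realType) (H : hilbertType R) (x : H) : R :=
  complex.Re `|x|.

(* The value lies in \bar R, where the infimum and suprema always exist. *)
Definition limsup2 (R : realType) (a : nat -> nat -> R) : \bar R :=
  ereal_inf [set ereal_sup [set (a NM.1 NM.2)%:E
                           | NM in [set NM : nat * nat |
                                     (K <= NM.1)%N /\ (K <= NM.2)%N]]
            | K in [set K : nat | (0 < K)%N]].

(* Main.v *)
Require Import Defs.
From HB Require Import structures.
From mathcomp Require Import all_boot all_order all_algebra.
From mathcomp Require Import sesquilinear complex.
From mathcomp Require Import all_classical all_reals all_analysis.
From mathcomp Require Import zify ring lra.

Set Implicit Arguments.
Unset Strict Implicit.
Unset Printing Implicit Defensive.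
Import Order.TTheory GRing.Theory Num.Theory.
Import numFieldNormedType.Exports.
Local Open Scope classical_set_scope.
Local Open Scope ring_scope.
Local Open Scope complex_scope.

(** Each correlation [g_j(N, M)], the mean of Re (u_n | u_(n+j)) over the window
    n = M+1, ..., M+N, has its own upper limit, so a bound from below on the
    Cesaro means of these upper limits follows as soon as, for every large J,
    the finite mean
      c_J(N, M) = (1/J) sum_(1 <= j <= J) g_j(N, M)
    is almost at least the left-hand side L on some windows with N and M
    arbitrarily large. (A van der Corput estimate would only control the Fejer
    means of the correlations.)

    The bound on c_J is the mean ergodic theorem in disguise. If shifting were an
    isometry T of a Hilbert space containing the vector u, then c_J would be
    (u | A_J u), where A_J = (1/J)(T + ... + T^J) converges strongly to the
    projection P on the fixed vectors, and (u | P u) = |P u|^2 would dominate the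
    squared norm of the mean of u. To see the convergence of (u | A_J u) without
    constructing P, let a_K = |A_K u|^2. Averaging the vector
    y = (1-t) A_J u + t u contracts it, and A_K y is almost A_K u when K is much
    larger than J, so that
      a_K <= (1-t)^2 a_J + 2 t (1-t) (u | A_J u) + t^2 |u|^2 + O(J/K).
    With t = 0 this says that a_K is eventually close to the infimum of the a_J.
    Then both a_K and a_J are close to this infimum, and dividing by 2t(1-t) for
    a small t > 0 gives (u | A_J u) >= inf_K a_K - o(1).

    On finite windows every step holds up to an error O(K/N): [avg_sq] is a_K,
    [avg_corr] is (u | A_J u), and [avg_sq_le] is the inequality above. No limit
    along windows is needed. The role of inf_K a_K is played by the supremum of
    those s such that each a_K exceeds s on all large windows among the ones where
    |mean of u|^2 is close to L ([mean_ergodic_lower_bound]). This supremum is at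
    least L, because the squared mean of u is at most a_K up to O(K/N)
    ([hnorm_avg_le_avg_sq]). *)

(** * Averages over windows *)

(** The partial application [avg N f] is again a sequence, so that iterated
    averages such as [avg N (avg K f)] can be formed. The window starts at M+1,
    hence [f 0] never occurs. *)
Definition avg (F : numFieldType) (V : lmodType F) (N : nat) (f : nat -> V)
  (M : nat) : V := N%:R^-1 *: \sum_(i < N) f (M + i).+1.

Lemma avg_nat (F : numFieldType) (V : lmodType F) N (f : nat -> V) M :
  N%:R^-1 *: \sum_(M.+1 <= n < (M + N).+1) f n = avg N f M.
Proof.
rewrite /avg big_add1/= -{1}[M]add0n big_addn addKn big_mkord.
by congr (_ *: _); apply: eq_bigr => i _; rewrite addnC.
Qed.

Lemma avgD (F : numFieldType) (V : lmodType F) N (f g : nat -> V) M :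
  avg N (fun n => f n + g n) M = avg N f M + avg N g M.
Proof. by rewrite /avg big_split scalerDr. Qed.

Lemma avgZ (F : numFieldType) (V : lmodType F) N a (f : nat -> V) M :
  avg N (fun n => a *: f n) M = a *: avg N f M.
Proof. by rewrite /avg -scaler_sumr !scalerA mulrC. Qed.

Lemma avg_sum (F : numFieldType) (V : lmodType F) N (I : Type) (r : seq I)
    (f : I -> nat -> V) M :
  avg N (fun n => \sum_(i <- r) f i n) M = \sum_(i <- r) avg N (f i) M.
Proof. by rewrite /avg exchange_big scaler_sumr. Qed.

Lemma avg_cst (F : numFieldType) (V : lmodType F) N (x : V) M :
  (0 < N)%N -> avg N (fun=> x) M = x.
Proof.
move=> N0; rewrite /avg sumr_const card_ord -[x *+ N]scaler_nat scalerA.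
by rewrite mulVf ?scale1r// pnatr_eq0 -lt0n.
Qed.

(** Averaging operators are convolutions with a fixed sequence of weights, so they
    commute. *)
Lemma avgC (F : numFieldType) (V : lmodType F) N K (f : nat -> V) M :
  avg N (avg K f) M = avg K (avg N f) M.
Proof.
rewrite /avg/= -!scaler_sumr !scalerA mulrC exchange_big/=; congr (_ *: _).
apply: eq_bigr => i _; apply: eq_bigr => j _; congr f.
by rewrite !addSn addnAC.
Qed.

Lemma ler_norm_avg (F : numFieldType) (V : normedModType F) N (f : nat -> V) M C :
  (forall n, `|f n| <= C) -> `|avg N f M| <= C.
Proof.
case: N => [|N] fC; rewrite /avg.
  by rewrite big_ord0 scaler0 normr0; exact: le_trans (fC 0%N).
rewrite normrZ normfV normr_nat ler_pdivrMl ?ltr0n//.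
apply: le_trans (ler_norm_sum _ _ _) _.
apply: le_trans (ler_sum _ (fun (i : 'I_N.+1) _ => fC _)) _.
by rewrite sumr_const card_ord mulr_natl.
Qed.

Lemma sum_shift (V : zmodType) N k (f : nat -> V) :
  \sum_(i < N) f i - \sum_(i < N) f (k + i)%N =
  \sum_(i < k) f i - \sum_(i < k) f (N + i)%N.
Proof.
apply/eqP; rewrite subr_eq addrAC eq_sym subr_eq; apply/eqP.
have H a b : \sum_(i < a) f i + \sum_(i < b) f (a + i)%N = \sum_(i < a + b) f i.
  by rewrite big_split_ord.
by rewrite !H addnC.
Qed.

(** Shifting a window by at most K steps removes at most K terms and adds as many,
    and [avg N (avg K f) M] is a mean of such shifted averages. *)
Lemma ler_dist_avg_avg (F : numFieldType) (V : normedModType F) N K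
    (f : nat -> V) M C : (0 < N)%N -> (0 < K)%N -> (forall n, `|f n| <= C) ->
  `|avg N f M - avg N (avg K f) M| <= 2 * K%:R * C / N%:R.
Proof.
move=> N0 K0 fC.
(* After exchanging the two averages, the difference is a mean over K shifts. *)
rewrite avgC -[X in X - _](avg_cst _ M K0).
have -> (x y : V) : x - y = x + (-1) *: y by rewrite scaleN1r.
rewrite -avgZ -avgD.
rewrite /avg normrZ normfV normr_nat ler_pdivrMl ?ltr0n//.
have C0 : 0 <= C by exact: le_trans (fC 0%N).
apply: le_trans (ler_norm_sum _ _ _) _.
have H (i : 'I_K) : true -> `|N%:R^-1 *: \sum_(i < N) f (M + i).+1 +
    -1 *: (N%:R^-1 *: \sum_(i0 < N) f ((M + i).+1 + i0).+1)| <= 2 * K%:R * C / N%:R.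
  move=> _.
  rewrite scaleN1r -scalerBr normrZ normfV normr_nat mulrC ler_wpM2r ?invr_ge0//.
  have -> : \sum_(j < N) f ((M + i).+1 + j).+1 =
    \sum_(j < N) (fun j => f (M + j).+1) (i.+1 + j)%N.
    by apply: eq_bigr => j _; rewrite /= addnA addnS.
  rewrite (sum_shift N i.+1 (fun j => f (M + j).+1)).
  apply: le_trans (ler_normB _ _) _.
  have S (g : nat -> V) : (forall n, `|g n| <= C) ->
      `|\sum_(j < i.+1) g j| <= K%:R * C.
    move=> gC; apply: le_trans (ler_norm_sum _ _ _) _.
    apply: le_trans (ler_sum _ (fun (j : 'I_i.+1) _ => gC _)) _.
    by rewrite sumr_const card_ord -[C *+ _]mulr_natl ler_wpM2r// ler_nat.
  by rewrite -mulrA mulr_natl mulr2n; apply: lerD;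
    [apply: (S (fun j => f (M + j).+1)) | apply: (S (fun j => f (M + (N + j)).+1))].
apply: le_trans (ler_sum _ H) _.
by rewrite sumr_const card_ord -[leLHS]mulr_natl.
Qed.

Lemma avgRE (R : realType) N (f : nat -> R) M :
  avg N (f : nat -> R^o) M = N%:R^-1 * \sum_(i < N) f (M + i).+1.
Proof. by []. Qed.

Lemma ler_avg (R : realType) N (f g : nat -> R) M : (forall n, f n <= g n) ->
  avg N (f : nat -> R^o) M <= avg N (g : nat -> R^o) M.
Proof.
by move=> fg; rewrite !avgRE ler_wpM2l ?invr_ge0//; apply: ler_sum => i _; exact: fg.
Qed.

(** * The real inner product *)

Section Hilbert.
Variables (R : realType) (H : hilbertType R).
Implicit Types x y : H.

Definition redot x y : R := complex.Re (inner x y).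

Lemma normC_hnorm x : `|x| = (hnorm x)%:C.
Proof.
rewrite /hnorm; have : `|x| \is Num.real by exact: normr_real.
by case: `|x| => a b; rewrite complex_real /= => /eqP ->.
Qed.

Lemma redotC x y : redot x y = redot y x.
Proof.
rewrite /redot (hermC (@inner R H) x y) expr0 mul1r.
have ReJ (z : R[i]) : complex.Re (Num.conj z) = complex.Re z by case: z.
exact: ReJ.
Qed.

Lemma redotDl x y z : redot (x + y) z = redot x z + redot y z.
Proof. by rewrite /redot linearDl raddfD. Qed.

Lemma redotZl (r : R) x y : redot (r%:C *: x) y = r * redot x y.
Proof.
have ReM (z : R[i]) : complex.Re (r%:C * z) = r * complex.Re z.
  by case: z => a b /=; rewrite mul0r subr0.
by rewrite /redot linearZl_LR ReM.
Qed.

Lemma hnormE x : hnorm x ^+ 2 = redot x x.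
Proof.
by rewrite /redot inner_normE normC_hnorm -rmorphXn.
Qed.

Lemma hnorm_ge0 x : 0 <= hnorm x.
Proof. by rewrite -lecR -normC_hnorm normr_ge0. Qed.

Lemma redot_suml (I : Type) (r : seq I) (f : I -> H) y :
  redot (\sum_(i <- r) f i) y = \sum_(i <- r) redot (f i) y.
Proof.
apply: (big_morph (redot^~ y) (fun a b => redotDl a b y)).
by rewrite -(scale0r 0) redotZl mul0r.
Qed.

Lemma redot_avgl N (f : nat -> H) M y :
  redot (avg N f M) y = avg N ((fun n => redot (f n) y) : nat -> R^o) M.
Proof.
rewrite avgRE -redot_suml -redotZl; congr redot.
by rewrite /avg fmorphV rmorph_nat.
Qed.

Lemma hnorm_comb (a b : R) x y : hnorm (a%:C *: x + b%:C *: y) ^+ 2 =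
  a ^+ 2 * hnorm x ^+ 2 + 2 * a * b * redot x y + b ^+ 2 * hnorm y ^+ 2.
Proof.
rewrite !hnormE redotDl !redotZl 2!(redotC _ (_ + _)) !redotDl !redotZl.
rewrite (redotC y x); ring.
Qed.

(** Convexity of the squared norm, read off from the nonnegative variance of the
    values of [f] around their mean. *)
Lemma hnorm_avg_le N (f : nat -> H) M : (0 < N)%N ->
  hnorm (avg N f M) ^+ 2 <= avg N ((fun n => hnorm (f n) ^+ 2) : nat -> R^o) M.
Proof.
move=> N0; set a := avg N f M.
have : 0 <=
    avg N ((fun n => hnorm (1%:C *: f n + (-1)%:C *: a) ^+ 2) : nat -> R^o) M.
  by rewrite avgRE mulr_ge0 ?invr_ge0// sumr_ge0// => i _; exact: sqr_ge0.
under [X in avg N X M]eq_fun do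
  rewrite hnorm_comb expr1n mul1r mulr1 sqrrN expr1n mul1r mulrN1.
rewrite (avgD (V := R^o)) (avgD (V := R^o)) (avg_cst (V := R^o))//.
rewrite (avgZ (V := R^o) N (- 2)) -redot_avgl -/a -hnormE.
rewrite /GRing.scale/=; lra.
Qed.

Lemma hnormD x y : hnorm (x + y) <= hnorm x + hnorm y.
Proof. by rewrite -lecR rmorphD /= -!normC_hnorm ler_normD. Qed.

Lemma hnormZ (r : R) x : hnorm (r%:C *: x) = `|r| * hnorm x.
Proof.
apply: complexI; rewrite -normC_hnorm normrZ rmorphM/= -normC_hnorm.
by rewrite normc_def/= expr0n/= addr0 sqrtr_sqr.
Qed.

Lemma hnorm_avg_bound N (f : nat -> H) M C :
  (forall n, hnorm (f n) <= C) -> hnorm (avg N f M) <= C.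
Proof.
move=> fC; rewrite -lecR -normC_hnorm; apply: ler_norm_avg => n.
by rewrite normC_hnorm lecR.
Qed.

Lemma hnorm_dist_avg_avg N K (f : nat -> H) M C : (0 < N)%N -> (0 < K)%N ->
  (forall n, hnorm (f n) <= C) ->
  hnorm (avg N f M - avg N (avg K f) M) <= 2 * K%:R * C / N%:R.
Proof.
move=> N0 K0 fC; rewrite -lecR -normC_hnorm.
rewrite !rmorphM/= fmorphV !rmorph_nat; apply: ler_dist_avg_avg => // n.
by rewrite normC_hnorm lecR.
Qed.

(** Factor the difference of squares and use the triangle inequality. *)
Lemma hnorm_sq_dist x y C d : hnorm x <= C -> hnorm y <= C ->
  hnorm (x - y) <= d -> hnorm x ^+ 2 <= hnorm y ^+ 2 + 2 * C * d.
Proof.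
move=> xC yC xyd; have := hnormD (x - y) y; rewrite subrK => xy.
have := hnorm_ge0 x; have := hnorm_ge0 y; have := hnorm_ge0 (x - y) => d0 y0 x0.
have Cd : 0 <= C * d by apply: mulr_ge0; lra.
have [h|h] := leP (hnorm x) (hnorm y); first by nra.
have : (hnorm x - hnorm y) * (hnorm x + hnorm y) <= d * (2 * C).
  by apply: ler_pM; lra.
by lra.
Qed.

Lemma avg_avg_le N K (f : nat -> R) M B : (0 < N)%N -> (0 < K)%N ->
  (forall n, `|f n| <= B) ->
  avg N (avg K (f : nat -> R^o)) M <= avg N (f : nat -> R^o) M + 2 * K%:R * B / N%:R.
Proof.
move=> N0 K0 fB.
have := @ler_dist_avg_avg R R^o N K f M B N0 K0 fB.
by rewrite ler_norml => /andP[+ _]; rewrite lerNl opprB lerBlDl.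
Qed.

Lemma ler_norm_redot x y C : hnorm x <= C -> hnorm y <= C ->
  `|redot x y| <= C ^+ 2.
Proof.
move=> xC yC.
have x2 : hnorm x ^+ 2 <= C ^+ 2.
  by rewrite ler_sqr ?nnegrE ?hnorm_ge0// (le_trans (hnorm_ge0 x)).
have y2 : hnorm y ^+ 2 <= C ^+ 2.
  by rewrite ler_sqr ?nnegrE ?hnorm_ge0// (le_trans (hnorm_ge0 y)).
have := hnorm_comb 1 1 x y; have := hnorm_comb 1 (-1) x y.
have := sqr_ge0 (hnorm (1%:C *: x + 1%:C *: y)).
have := sqr_ge0 (hnorm (1%:C *: x + (-1)%:C *: y)).
by rewrite ler_norml => *; apply/andP; split; lra.
Qed.

(** * The finite form of the ergodic inequality *)

Section Averages.
Variables (u : nat -> H) (C : R).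
Hypothesis uC : forall n, hnorm (u n) <= C.

Definition avg_sq K N M : R :=
  avg N ((fun n => hnorm (avg K u n) ^+ 2) : nat -> R^o) M.

Definition avg_corr m N M : R :=
  avg N ((fun n => redot (u n) (avg m u n)) : nat -> R^o) M.

(** Replacing [u] by [avg K u] barely changes its mean over a long window; then
    convexity applies. *)
Lemma hnorm_avg_le_avg_sq K N M : (0 < K)%N -> (0 < N)%N ->
  hnorm (avg N u M) ^+ 2 <= avg_sq K N M + 4 * K%:R * C ^+ 2 / N%:R.
Proof.
move=> K0 N0; have H1 := hnorm_dist_avg_avg M N0 K0 uC.
have AC := fun n => hnorm_avg_bound K n uC.
have := hnorm_sq_dist (hnorm_avg_bound N M uC) (hnorm_avg_bound N M AC) H1.
have := hnorm_avg_le (avg K u) M N0; rewrite -/(avg_sq K N M).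
have -> : 2 * C * (2 * K%:R * C / N%:R) = 4 * K%:R * C ^+ 2 / N%:R by ring.
by lra.
Qed.

Lemma avg_sq_bound K N M : 0 <= avg_sq K N M <= C ^+ 2.
Proof.
apply/andP; split.
  by rewrite /avg_sq avgRE mulr_ge0 ?invr_ge0// sumr_ge0// => i _; exact: sqr_ge0.
apply: le_trans (ler_norm _) _; apply: (@ler_norm_avg R R^o) => n.
rewrite ger0_norm ?sqr_ge0// ler_sqr ?nnegrE ?hnorm_ge0//.
  exact: hnorm_avg_bound.
exact: le_trans (hnorm_ge0 (u 0%N)) (uC 0%N).
Qed.

(** Here [avg K] is a contraction for the mean square, up to the boundary effects
    2KC^2/N, and it maps y = (1-t) avg_m u + t u almost to the same sequence as
    [u]: averaging over m steps first is invisible to an average over K steps, up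
    to an error of order m/K in norm. The first three terms of the bound come from
    expanding the square of y. *)
Lemma avg_sq_le t K m N M : 0 <= t <= 1 -> (0 < K)%N -> (0 < m)%N -> (0 < N)%N ->
  avg_sq K N M <= (1 - t) ^+ 2 * avg_sq m N M + 2 * (1 - t) * t * avg_corr m N M
    + t ^+ 2 * C ^+ 2 + 2 * K%:R * C ^+ 2 / N%:R + 4 * m%:R * C ^+ 2 / K%:R.
Proof.
move=> /andP[t0 t1] K0 m0 N0.
pose y n := (1 - t)%:C *: avg m u n + t%:C *: u n.
have AC := fun n => hnorm_avg_bound m n uC.
have C0 : 0 <= C by exact: le_trans (hnorm_ge0 (u 0%N)) (uC 0%N).
have yC n : hnorm (y n) <= C.
  rewrite /y; apply: le_trans (hnormD _ _) _; rewrite !hnormZ !ger0_norm ?subr_ge0//.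
  have := AC n; have := uC n; nra.
have d0 : 0 <= 2 * m%:R * C / K%:R by rewrite !mulr_ge0// invr_ge0.
(* Pointwise comparison of avg K u with avg K y, followed by convexity. *)
have st1 n : hnorm (avg K u n) ^+ 2 <=
    avg K ((fun n => hnorm (y n) ^+ 2) : nat -> R^o) n + 4 * m%:R * C ^+ 2 / K%:R.
  have -> : 4 * m%:R * C ^+ 2 / K%:R = 2 * C * (2 * m%:R * C / K%:R) by ring.
  apply: le_trans (lerD (hnorm_avg_le y n K0) (lexx _)).
  apply: hnorm_sq_dist; rewrite ?hnorm_avg_bound//.
  rewrite avgD (avgZ K (1 - t)%:C) (avgZ K t%:C).
  (* Only the part (1-t) avg K (avg m u) of avg K y differs from avg K u. *)
  have -> : avg K u n - ((1 - t)%:C *: avg K (avg m u) n + t%:C *: avg K u n) =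
    (1 - t)%:C *: (avg K u n - avg K (avg m u) n).
    rewrite scalerBr opprD addrCA addrC; congr (_ - _).
    by rewrite rmorphB/= scalerBl scale1r.
  rewrite hnormZ ger0_norm ?subr_ge0//.
  have := hnorm_dist_avg_avg n K0 m0 uC.
  by have := hnorm_ge0 (avg K u n - avg K (avg m u) n); nra.
have st2 : avg_sq K N M <= avg N (avg K ((fun n => hnorm (y n) ^+ 2) : nat -> R^o)) M
     + 4 * m%:R * C ^+ 2 / K%:R.
  rewrite -[X in _ + X](avg_cst (V := R^o) _ M N0) -avgD.
  exact: ler_avg.
apply: le_trans st2 _; rewrite lerD2r.
(* Drop the inner average over K at the cost of the boundary terms. *)
apply: le_trans (avg_avg_le (B := C ^+ 2) M N0 K0 _) _.
  by move=> n; rewrite ger0_norm ?sqr_ge0// ler_sqr ?nnegrE ?hnorm_ge0.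
rewrite lerD2r.
under [X in avg N X M]eq_fun do rewrite hnorm_comb.
rewrite (avgD (V := R^o)) (avgD (V := R^o)).
rewrite !(avgZ (V := R^o)) -/(avg_sq m N M).
under [X in avg N X M]eq_fun do rewrite redotC.
rewrite -/(avg_corr m N M) lerD2l /GRing.scale/= ler_wpM2l ?sqr_ge0//.
rewrite -[leRHS](avg_cst (V := R^o) _ M N0).
by apply: ler_avg => n; rewrite ler_sqr ?nnegrE ?hnorm_ge0.
Qed.

Lemma avg_corrE m N M : avg_corr m N M =
  m%:R^-1 * \sum_(1 <= j < m.+1)
    avg N ((fun n => redot (u n) (u (n + j)%N)) : nat -> R^o) M.
Proof.
rewrite big_add1 big_mkord /avg_corr.
have E n : redot (u n) (avg m u n) =
    m%:R^-1 * \sum_(j < m) redot (u n) (u (n + j.+1)%N).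
  rewrite redotC redot_avgl avgRE; congr (_ * _).
  by apply: eq_bigr => j _; rewrite redotC addnS.
under [X in avg N X M]eq_fun do rewrite E.
by rewrite (avgZ (V := R^o)) (avg_sum (V := R^o)).
Qed.

End Averages.
End Hilbert.

(** * Passing to the limit *)

(** The ergodic theorem reduced to inequalities between real numbers. The third
    hypothesis says that the mean square a_K dominates ell, the fourth is the
    inequality of [avg_sq_le]; the conclusion bounds c_J from below on windows
    arbitrarily far away, with a rank J0 that is chosen before the window. This
    uniformity is what the supremum [L] below provides: all a_K exceed L - d on
    the relevant large windows, while a single a_(K0) is below L + d on arbitrarily
    large ones. On a window of the second kind every a_J with J much larger than
    K0 is also trapped near L, and the inequality for the pair (K, J) with K much
    larger than J forces c_J up. *)
Lemma mean_ergodic_lower_bound (R : realType) (ell : nat -> nat -> R)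
    (a c : nat -> nat -> nat -> R) (B r : R) :
  0 < B ->
  (forall K N M, 0 <= a K N M <= B) ->
  (forall K N M, (0 < K)%N -> (0 < N)%N ->
     ell N M <= a K N M + 4 * K%:R * B / N%:R) ->
  (forall t K m N M, 0 <= t <= 1 -> (0 < K)%N -> (0 < m)%N -> (0 < N)%N ->
     a K N M <= (1 - t) ^+ 2 * a m N M + 2 * (1 - t) * t * c m N M
       + t ^+ 2 * B + 2 * K%:R * B / N%:R + 4 * m%:R * B / K%:R) ->
  (forall K1, exists N M, [/\ (K1 <= N)%N, (K1 <= M)%N & r < ell N M]) ->
  forall e, 0 < e -> exists J0, forall J, (J0 <= J)%N -> (0 < J)%N ->
    forall K1, exists N M, [/\ (K1 <= N)%N, (K1 <= M)%N & r - e <= c J N M].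
Proof.
move=> B0 aB aI aII freq e e0.
pose S := [set s : R | forall K, (0 < K)%N -> exists K1, forall N M,
  (K1 <= N)%N -> (K1 <= M)%N -> r < ell N M -> s < a K N M].
have small (x d : R) : 0 < d -> 0 <= x -> exists K1, forall N,
    (K1 <= N)%N -> (0 < N)%N -> x / N%:R <= d.
  move=> d0 x0; have [K1 hK1] : exists K1 : nat, x / d <= K1%:R.
    by exists (Num.bound (x / d)); apply/ltW/archi_boundP; rewrite divr_ge0// ltW.
  exists K1 => N K1N N0; rewrite ler_pdivrMr ?ltr0n// mulrC -ler_pdivrMr//.
  by apply: le_trans hK1 _; rewrite ler_nat.
have Slt s : s < 0 -> S s.
  move=> s0 K _; exists 0%N => N M _ _ _; apply: lt_le_trans s0 _.
  by case/andP: (aB K N M).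
have Sr s : s < r -> S s.
  move=> sr K K0; have [||K1 hK1] := small (4 * K%:R * B) (r - s).
  - by rewrite subr_gt0.
  - by rewrite !mulr_ge0// ltW.
  exists K1.+1 => N M /= K1N _ rl.
  have N0 : (0 < N)%N by exact: leq_ltn_trans K1N.
  have := hK1 N (ltnW K1N) N0; have := aI K N M K0 N0; lra.
have SB : ubound S B.
  move=> s /(_ 1%N isT)[K1 h]; have [N [M [N1 M1 rl]]] := freq K1.
  by apply: ltW; apply: lt_le_trans (h _ _ N1 M1 rl) _; case/andP: (aB 1%N N M).
have supS : has_sup S by split; [exists (-1); apply: Slt; lra | exists B].
pose L := sup S.
have L0 : 0 <= L.
  apply/ler_addgt0Pr => d d0; rewrite -lerBlDr; apply: ub_le_sup; first by exists B.
  by apply: Slt; lra.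
have rL : r <= L.
  apply/ler_addgt0Pr => d d0; rewrite -lerBlDr; apply: ub_le_sup; first by exists B.
  by apply: Sr; lra.
(* The bound obtained below is c_J >= L - t (2B + 6), provided that t <= 1/2. *)
pose t := Num.min 2^-1 (e / (2 * B + 6)).
have t0 : 0 < t by rewrite lt_min; apply/andP; split; [lra|apply: divr_gt0; lra].
have t1 : t <= 2^-1 by rewrite ge_min lexx.
have te : t * (2 * B + 6) <= e by rewrite -ler_pdivlMr ?ge_min ?lexx ?orbT//; lra.
(* The errors must be negligible after the division by t. *)
pose d := t ^+ 2.
have d0 : 0 < d by exact: exprn_gt0.
have SLd : S (L - d).
  have [s Ss Ls] := sup_adherent d0 supS.
  move=> K K0; have [K1 h] := Ss K K0; exists K1 => N M N1 M1 rl.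
  by apply: lt_trans Ls (h _ _ N1 M1 rl).
have [K0 K00 lowK0] : exists2 K0, (0 < K0)%N & forall K1, exists N M,
    [/\ (K1 <= N)%N, (K1 <= M)%N, r < ell N M & a K0 N M <= L + d].
  apply: contrapT => H; have : S (L + d); last first.
    by move=> /(ub_le_sup (ex_intro _ B SB)); rewrite -/L; lra.
  move=> K Kp; apply: contrapT => H1; apply: H; exists K => // K1.
  apply: contrapT => H2; apply: H1; exists K1 => N M N1 M1 rl.
  rewrite ltNge; apply/negP => ale; apply: H2; by exists N, M.
have [|J0 hJ0] := small (4 * K0%:R * B) d d0; first by rewrite !mulr_ge0// ltW.
exists J0 => J J0J Jp K1.
have [|Ka hKa] := small (4 * J%:R * B) d d0; first by rewrite !mulr_ge0// ltW.
pose K := Ka.+1.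
have [K2 hK2] := SLd K isT.
have [|K3 hK3] := small (2 * K%:R * B) d d0; first by rewrite !mulr_ge0// ltW.
have [|K4 hK4] := small (2 * J%:R * B) d d0; first by rewrite !mulr_ge0// ltW.
(* A window where a_(K0) is low, so large that all boundary terms are at most d. *)
have [N [M [N1 M1 rl a0]]] := lowK0 (K1 + K2 + K3 + K4).+1.
have Np : (0 < N)%N by exact: leq_ltn_trans N1.
exists N, M; split; [lia|lia|].
have aK := hK2 N M ltac:(lia) ltac:(lia) rl.
have e3 := hK3 N ltac:(lia) Np.
have e4 := hK4 N ltac:(lia) Np.
have eJ := hJ0 J J0J Jp.
have eK := hKa K (leqnSn _) isT.
(* The case t = 0 for the pair (J, K0) bounds a_J from above. *)
have := aII 0 J K0 N M _ Jp K00 Np; rewrite lexx ler01 => /(_ isT).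
rewrite subr0 expr1n mul1r mulr0 mul0r expr0n/= mul0r => aJ.
(* For the pair (K, J) it bounds c_J from below. *)
have := aII t K J N M _ isT Jp Np.
have -> : 0 <= t <= 1 by apply/andP; split; lra.
move=> /(_ isT) aKt.
have aJ3 : a J N M <= L + 3 * d by lra.
have t2 : (1 - t) ^+ 2 * a J N M <= (1 - t) ^+ 2 * (L + 3 * d).
  by rewrite ler_wpM2l ?sqr_ge0.
have X : 2 * (1 - t) * (L - t * (2 * B + 6)) * t <= 2 * (1 - t) * c J N M * t.
  have p1 : (1 - t) ^+ 2 * t ^+ 2 <= t ^+ 2.
    by rewrite ler_piMl ?sqr_ge0// expr_le1//; lra.
  have p2 : 0 <= t ^+ 2 * L by rewrite mulr_ge0// sqr_ge0.
  have p3 : 0 <= t ^+ 2 * ((1 - 2 * t) * (2 * B + 6)).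
    by rewrite !mulr_ge0 ?sqr_ge0//; lra.
  have p4 : 0 <= t ^+ 2 * B by rewrite mulr_ge0 ?sqr_ge0// ltW.
  rewrite /d in aK aKt e3 eK t2; lra.
have : 2 * (1 - t) * (L - t * (2 * B + 6)) <= 2 * (1 - t) * c J N M.
  by rewrite -(ler_pM2r t0).
rewrite ler_pM2l; [lra|lra].
Qed.

Section Limsup2.
Variable R : realType.
Implicit Type a : nat -> nat -> R.

Lemma limsup2_gt a (r : R) : (r%:E < limsup2 a)%E ->
  forall K, exists N M, [/\ (K <= N)%N, (K <= M)%N & r < a N M].
Proof.
move=> ra K; have /ereal_sup_gt[_ [[N M] /= [KN KM] <-]] :
    (r%:E < ereal_sup [set (a NM.1 NM.2)%:E | NM in [set NM : nat * nat |
       (K.+1 <= NM.1)%N /\ (K.+1 <= NM.2)%N]])%E.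
  by apply: lt_le_trans ra _; apply: ereal_inf_lbound; exists K.+1.
by rewrite lte_fin => rNM; exists N, M; split => //; exact: ltnW.
Qed.

Lemma limsup2_lt a (r : R) : (limsup2 a < r%:E)%E ->
  exists K, forall N M, (K <= N)%N -> (K <= M)%N -> a N M < r.
Proof.
move=> /ereal_inf_lt[_ [K _ <-]] ar; exists K => N M KN KM.
rewrite -lte_fin; apply: le_lt_trans ar; apply: ereal_sup_ubound.
by exists (N, M).
Qed.

Lemma limsup2_fin a B : (forall N M, `|a N M| <= B) ->
  limsup2 a \is a fin_num.
Proof.
move=> aB; rewrite fin_numElt; apply/andP; split.
  apply: (@lt_le_trans _ _ (- B)%:E); first exact: ltNyr.
  apply: le_ereal_inf_tmp => _ [K _ <-].
  apply: le_trans (ereal_sup_ubound _); last by exists (K, K).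
  by rewrite lee_fin; have := aB K K; rewrite ler_norml => /andP[].
apply: (@le_lt_trans _ _ B%:E); last exact: ltry.
apply: le_trans (ereal_inf_lbound _) _; first by exists 1%N.
apply: ge_ereal_sup => _ [[N M] _ <-] /=.
by rewrite lee_fin; apply: le_trans (aB N M); exact: ler_norm.
Qed.
End Limsup2.

Lemma limn_einf_ge (R : realType) (v : nat -> \bar R) (x : \bar R) n :
  (forall k, (n <= k)%N -> (x <= v k)%E) -> (x <= limn_einf v)%E.
Proof.
move=> xv; rewrite limn_einf_lim (cvg_lim _ (@cvg_einfs_sup _ v))//.
apply: le_ereal_sup_tmp; exists (einfs v n); first by exists n.
by apply: le_ereal_inf_tmp => _ [k /= nk <-]; exact: xv.
Qed.

Theorem corollary5p3 (R : realType) (H : hilbertType R) (u : nat -> H)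
    (hu : [bounded u n | n in [set n : nat | (0 < n)%N]]) :
  (limsup2 (fun N M : nat =>
       hnorm (N%:R^-1 *: \sum_(M.+1 <= n < (M + N).+1) u n) ^+ 2)%R
   <= limn_einf (fun J : nat =>
        (J%:R^-1)%:E *
        \sum_(1 <= j < J.+1)
          limsup2 (fun N M : nat =>
            N%:R^-1 * \sum_(M.+1 <= n < (N + M).+1)
              complex.Re (inner (u n) (u (n + j)%N)))%R))%E.
Proof.
have [C C0 uC] : exists2 C : R, 0 < C & forall n, hnorm (u n) <= C.
  have [c c0 uc] := ex_strict_bound_gt0 hu.
  (* The value u 0 is unconstrained; including it makes the bound uniform. *)
  exists (Num.max (complex.Re c) (hnorm (u 0%N))).
    by rewrite lt_max; move: c0; rewrite ltcE => /andP[_ ->].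
  case=> [|n]; rewrite le_max; first by rewrite lexx orbT.
  have := uc n.+1 isT; rewrite /= normC_hnorm ltcE => /andP[_ /ltW h].
  by apply/orP; left.
pose ell N M := hnorm (avg N u M) ^+ 2.
pose g j N M : R := avg N ((fun n => redot (u n) (u (n + j)%N)) : nat -> R^o) M.
have -> : (fun N M : nat =>
    hnorm (N%:R^-1 *: \sum_(M.+1 <= n < (M + N).+1) u n) ^+ 2) = ell.
  by apply/funext => N; apply/funext => M; rewrite avg_nat.
have gE j : (fun N M : nat => N%:R^-1 * \sum_(M.+1 <= n < (N + M).+1)
    complex.Re (inner (u n) (u (n + j)%N)))%R = g j.
  apply/funext => N; apply/funext => M; rewrite [(N + M)%N]addnC.
  exact: (avg_nat (V := R^o)).
under [X in limn_einf X]eq_fun do under eq_bigr do rewrite gE.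
have gB j N M : `|g j N M| <= C ^+ 2.
  by apply: (@ler_norm_avg R R^o) => n; exact: ler_norm_redot.
have ellB N M : `|ell N M| <= C ^+ 2.
  rewrite ger0_norm ?sqr_ge0// ler_sqr ?nnegrE ?hnorm_ge0 ?(ltW C0)//.
  exact: hnorm_avg_bound.
pose G j := fine (limsup2 (g j)).
have GE j : limsup2 (g j) = (G j)%:E by rewrite fineK// (limsup2_fin (gB j)).
under [X in limn_einf X]eq_fun => J.
  under eq_bigr do rewrite GE.
  rewrite sumEFin -EFinM.
  over.
apply/lee_subgt0Pr => e e0.
have -> : limsup2 ell = (fine (limsup2 ell))%:E.
  by rewrite fineK// (limsup2_fin ellB).
set L := fine _.
have e3 : 0 < e / 3 by lra.
have freq : forall K1, exists N M,
    [/\ (K1 <= N)%N, (K1 <= M)%N & L - e / 3 < ell N M].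
  apply: limsup2_gt; rewrite -[ltRHS]fineK ?(limsup2_fin ellB)// lte_fin -/L; lra.
(* The tolerance e is shared between the choice of ell near L, the ergodic bound
   and the upper limits of the finitely many g_j. *)
have [||||J0 hJ0] := mean_ergodic_lower_bound (a := avg_sq u) (c := avg_corr u)
  (B := C ^+ 2) _ _ _ _ freq e3.
- exact: exprn_gt0.
- by move=> *; exact: avg_sq_bound.
- by move=> *; exact: hnorm_avg_le_avg_sq.
- by move=> *; exact: avg_sq_le.
apply: (limn_einf_ge (n := J0.+1)) => J J0J.
rewrite -EFinB lee_fin.
have [K hK] : exists K, forall j N M, (j <= J)%N -> (K <= N)%N -> (K <= M)%N ->
    g j N M < G j + e / 3.
  have /choice[f hf] : forall j, exists K, forall N M, (K <= N)%N -> (K <= M)%N ->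
      g j N M < G j + e / 3.
    by move=> j; apply: limsup2_lt; rewrite GE lte_fin; lra.
  exists (\max_(j < J.+1) f j) => j N M jJ.
  have fj := leq_bigmax (F := fun j : 'I_J.+1 => f j) (Ordinal (jJ : (j < J.+1)%N)).
  by move=> KN KM; apply: hf; apply: leq_trans fj _.
have Jp : (0 < J)%N by exact: leq_ltn_trans J0J.
have [N [M [KN KM]]] := hJ0 J (ltnW J0J) Jp K.
rewrite avg_corrE => cJ.
suff : J%:R^-1 * \sum_(1 <= j < J.+1) g j N M <=
    J%:R^-1 * (\sum_(1 <= j < J.+1) G j) + e / 3.
  by move: cJ; rewrite /g; lra.
have -> : e / 3 = J%:R^-1 * \sum_(1 <= j < J.+1) (e / 3).
  rewrite sumr_const_nat subSS subn0 -[(e / 3) *+ J]mulr_natl.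
  by rewrite mulKf// pnatr_eq0 -lt0n.
rewrite -mulrDr -big_split ler_wpM2l ?invr_ge0//.
by apply: ler_sum_nat => j /andP[_ jJ]; apply/ltW; exact: hK.
Qed.
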